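(* Let $d\ge1$ and let $P$ be a non-degenerate elliptical distribution on $\mathbb{R}^d$. Let $S\subset\mathbb{R}^d$, and suppose that $S$ is not a symmetric-matrix uniqueness set. Then there exists a non-degenerate elliptical distribution $Q$ on $\mathbb{R}^d$ such that $P_{\langle x\rangle}=Q_{\langle x\rangle}$ for all $x\in S$, but $P\ne Q$.
   Context: Elements of $\mathbb{R}^d$ are column vectors. A Borel probability measure $P$ on $\mathbb{R}^d$ is an elliptical distribution if its characteristic function $\phi_P(\xi)=\int e^{ix\cdot\xi}\,dP(x)$ has the form $\phi_P(\xi)=e^{i\mu\cdot\xi}\psi(\xi^\top\Sigma\xi)$ for all $\xi\in\mathbb{R}^d$, where $\Sigma$ is a real (symmetric) positive semi-definite $d\times d$ matrix, $\mu\in\mathbb{R}^d$, and $\psi:[0,\infty)\to\mathbb{C}$ is continuous ($\mu,\Sigma,\psi$ may depend on $P$). A Borel probability measure on $\mathbb{R}^d$ is non-degenerate if it is not supported in any hyperplane, where a hyperplane is a set $\{x\in\mathbb{R}^d: y\cdot x=c\}$ with $y\in\mathbb{R}^d\setminus\{0\}$ and $c\in\mathbb{R}$. A set $S\subset\mathbb{R}^d$ is a symmetric-matrix uniqueness set if the only real symmetric $d\times d$ matrix $A$ satisfying $x^\top Ax=0$ for all $x\in S$ is the zero matrix. For a vector subspace $H\subset\mathbb{R}^d$ with orthogonal projection $\pi_H:\mathbb{R}^d\to H$, $P_H$ denotes the Borel probability measure on $H$ given by $P_H(B)=P(\pi_H^{-1}(B))$. For $x\in\mathbb{R}^d$, $\langle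 x\rangle$ denotes the linear span of $x$ (one-dimensional if $x\neq0$, and $\{0\}$ if $x=0$). *)

(* Defs.v *)
From HB Require Import structures.
From mathcomp Require Import all_boot all_order all_algebra.
From mathcomp Require Import all_classical all_reals all_analysis.
From mathcomp.real_closed Require Import complex.

Set Implicit Arguments.
Unset Strict Implicit.
Unset Printing Implicit Defensive.

Import Order.TTheory GRing.Theory Num.Theory.
Import numFieldNormedType.Exports.

Local Open Scope classical_set_scope.
Local Open Scope ring_scope.
Local Open Scope complex_scope.

(* R^d with its Borel sigma-algebra. *)
Definition borelRd (R : realType) (d : nat) : measurableType _ :=
  g_sigma_algebraType (@open 'cV[R]_d).

Definition dot (R : realType) (d : nat) (x y : 'cV[R]_d) : R :=
  (x^T *m y) ord0 ord0.

Definition qform (R : realType) (d : nat) (A : 'M[R]_d) (x : 'cV[R]_d) : R :=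
  (x^T *m A *m x) ord0 ord0.

Definition psdmx (R : realType) (d : nat) (A : 'M[R]_d) : Prop :=
  A \is symmetricmx /\ forall x, 0 <= qform A x.

(* e^{i t} *)
Definition expi (R : realType) (t : R) : R[i] := cos t +i* sin t.

(* Library integrals are real-valued, hence the componentwise definition. *)
Definition cintegral (R : realType) (d : nat)
    (P : probability (borelRd R d) R) (f : borelRd R d -> R[i]) : R[i] :=
  Rintegral P setT (fun x => complex.Re (f x)) +i* Rintegral P setT (fun x => complex.Im (f x)).

Definition charfun (R : realType) (d : nat)
    (P : probability (borelRd R d) R) (xi : 'cV[R]_d) : R[i] :=
  cintegral P (fun x => expi (dot x xi)).

(* psi : [0, +oo[ -> C is encoded by a total function, of which only the
   restriction to [0, +oo[ matters; R[i]^o carries the topology of the modulus. *)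
Definition elliptical (R : realType) (d : nat)
    (P : probability (borelRd R d) R) : Prop :=
  exists (mu : 'cV[R]_d) (Sigma : 'M[R]_d) (psi : R -> R[i]^o),
    [/\ psdmx Sigma,
        {within `[0, +oo[, continuous psi} &
        forall xi, charfun P xi = expi (dot mu xi) * psi (qform Sigma xi)].

Definition hyperplane (R : realType) (d : nat) (H : set 'cV[R]_d) : Prop :=
  exists (y : 'cV[R]_d) (c : R), y != 0 /\ H = [set x | dot y x = c].

Definition nondegenerate_measure (R : realType) (d : nat)
    (P : probability (borelRd R d) R) : Prop :=
  forall H : set 'cV[R]_d, hyperplane H -> P H <> 1%E.

Definition sym_uniqueness_set (R : realType) (d : nat)
    (S : set 'cV[R]_d) : Prop :=
  forall A : 'M[R]_d, A \is symmetricmx ->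
    (forall x, S x -> qform A x = 0) -> A = 0.

(* The orthogonal projection of x onto H: the point h of H such that x - h is
   orthogonal to H. *)
Definition orthproj (R : realType) (d : nat) (H : {vspace 'cV[R]_d})
    (x : borelRd R d) : borelRd R d :=
  get [set h : 'cV[R]_d | h \in H /\ forall y, y \in H -> dot (x - h) y = 0].

(* P_H (B) = P (pi_H^-1 (B)); only its values on the Borel subsets of H are
   meaningful. *)
Definition projm (R : realType) (d : nat) (P : probability (borelRd R d) R)
    (H : {vspace 'cV[R]_d}) : set (borelRd R d) -> \bar R :=
  pushforward P (orthproj H).

(* P_H = Q_H: as H is closed in R^d, the Borel subsets of H are exactly the
   Borel subsets of R^d contained in H. *)
Definition eq_projm (R : realType) (d : nat)
    (P Q : probability (borelRd R d) R) (H : {vspace 'cV[R]_d}) : Prop :=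
  forall B : set (borelRd R d), measurable B -> B `<=` [set` H] ->
    projm P H B = projm Q H B.

(* Equality of Borel measures.  Leibniz equality of probability records would
   also compare the values on non-measurable sets. *)
Definition eq_borel (R : realType) (d : nat)
    (P Q : probability (borelRd R d) R) : Prop :=
  forall B : set (borelRd R d), measurable B -> P B = Q B.

(* Main.v *)
From HB Require Import structures.
Require Import Defs.
From mathcomp Require Import all_boot all_order all_algebra.
From mathcomp Require Import all_classical all_reals all_analysis.
From mathcomp Require Import measurable_realfun ring lra.
From mathcomp.real_closed Require Import complex.
Import Order.TTheory GRing.Theory Num.Theory.
Import numFieldNormedType.Exports.
Local Open Scope classical_set_scope.
Local Open Scope ring_scope.

(** The new distribution is an affine image of the old one.  Write the
characteristic function of [P] as [exp(i mu.xi) psi(xi^T Sigma xi)].  As [P] is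
non-degenerate, [Sigma] is positive definite: a vector of its kernel would be a
direction in which [P] is a point mass.  A set [S] that is not a uniqueness set
comes with a symmetric [A <> 0] whose quadratic form vanishes on [S], and for
small [e > 0] the matrix [Sigma + e A] is still positive definite, hence of the
form [T Sigma T^T] with [T] invertible ([congruence_perturb], from two Cholesky
factorizations).  Let [Q] be the law of [T (X - mu) + mu] for [X] of law [P];
its characteristic function is [exp(i mu.xi) psi(xi^T (Sigma + e A) xi)].

Along a line spanned by a point of [S] the two characteristic functions agree,
because [A] contributes nothing there.  Restricted to a line they are the
characteristic functions of the one-dimensional marginals, so the projections
agree as soon as a probability on the line is determined by its characteristic
function ([charfun_line_unique]).

That uniqueness theorem is proved without any kernel or inversion formula.  The
functions having the same Fourier transform against both measures form a space
stable under multiplication by [cos (t x + s)].  It contains [1], hence every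
[(1 - u^n)^m] with [u = (1 + cos (t x + s)) / 2], and for [m = n 2^n] these
converge boundedly to the indicator of [u < 1/2], that is, of
[sin (t (x - b)) > 0] for a suitable phase [s].  Letting [t] tend to [0] gives
the indicator of [x > b], and such half-lines determine a measure.

Finally [P] and [Q] differ.  Otherwise [psi (s a) = psi (s b)] for all [s >= 0],
where [a] and [b] are the values of the forms [Sigma] and [Sigma + e A] at a
vector at which the form [A] does not vanish; as [a <> b] are positive and [psi]
is continuous at [0], [psi] is constant ([two_scale_invariant]).  Then [P] would
be a point mass in every direction. *)

Section EllipticalDistributions.
Set Implicit Arguments.
Unset Strict Implicit.
Context (R : realType).

(** * Means of bounded functions *)

Definition bounded_measurable d (T : measurableType d) (f : T -> R) : Prop :=
  measurable_fun [set: T] f /\ exists M : R, forall x, `|f x| <= M.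

Lemma bounded_measurable_integrable d (T : measurableType d)
    (P : probability T R) (f : T -> R) :
  bounded_measurable f -> P.-integrable setT (EFin \o f).
Proof.
move=> [mf [M fM]]; apply: measurable_bounded_integrable => //.
  by rewrite [X in (X < _)%E]probability_setT ltry.
exists M; split=> [|N MN]; rewrite ?num_real// => x _.
exact: le_trans (fM x) (ltW MN).
Qed.

Lemma bounded_measurable_comp d1 d2 (T1 : measurableType d1)
    (T2 : measurableType d2) (f : T1 -> T2) (g : T2 -> R) :
  measurable_fun [set: T1] f -> bounded_measurable g ->
  bounded_measurable (fun x => g (f x)).
Proof.
move=> mf [mg [M gM]]; split; last by exists M => x.
exact: (measurableT_comp mg mf).
Qed.

Lemma bounded_measurableZ d (T : measurableType d) a (f : T -> R) :
  bounded_measurable f -> bounded_measurable (fun x => a * f x).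
Proof.
move=> [mf [M fM]]; split; first exact: measurable_funM.
by exists (`|a| * M) => x; rewrite normrM ler_wpM2l.
Qed.

Lemma bounded_measurable_lin d (T : measurableType d) a b (f g : T -> R) :
  bounded_measurable f -> bounded_measurable g ->
  bounded_measurable (fun x => a * f x + b * g x).
Proof.
move=> /(bounded_measurableZ a)[mf [M fM]] /(bounded_measurableZ b)[mg [N gN]].
split; first exact: measurable_funD.
by exists (M + N) => x; apply: le_trans (ler_normD _ _) _; rewrite lerD.
Qed.

Lemma Rintegral_lin d (T : measurableType d) (P : probability T R) a b
    (f g : T -> R) :
  bounded_measurable f -> bounded_measurable g ->
  \int[P]_x (a * f x + b * g x) = a * \int[P]_x f x + b * \int[P]_x g x.
Proof.
move=> bf bg; have bi := @bounded_measurable_integrable _ _ P.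
rewrite RintegralD ?RintegralZl//; try exact: bi.
  by apply: bi; exact: bounded_measurableZ.
by apply: bi; exact: bounded_measurableZ.
Qed.

Lemma bounded_measurable_cos : bounded_measurable (@cos R).
Proof.
split; last by exists 1 => x; exact: cos_max.
by apply: continuous_measurable_fun; exact: continuous_cos.
Qed.

Lemma bounded_measurable_sin : bounded_measurable (@sin R).
Proof.
split; last by exists 1 => x; exact: sin_max.
by apply: continuous_measurable_fun; exact: continuous_sin.
Qed.

Lemma measurable_scale_line (t : R) : measurable_fun [set: R] (fun x : R => t * x).
Proof.
by apply: continuous_measurable_fun => x; apply: cvgM; [exact: cvg_cst|exact: cvg_id].
Qed.

Lemma bounded_measurable_cosZ t :
  bounded_measurable (fun x : measurableTypeR R => cos (t * x)).
Proof.
exact: bounded_measurable_comp (measurable_scale_line t) bounded_measurable_cos.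
Qed.

Lemma bounded_measurable_sinZ t :
  bounded_measurable (fun x : measurableTypeR R => sin (t * x)).
Proof.
exact: bounded_measurable_comp (measurable_scale_line t) bounded_measurable_sin.
Qed.

(** The pushforward of [P] by [f], taking measurability as an explicit proof so
that laws of unnamed maps need no canonical instance. *)
Definition law d1 d2 (T1 : measurableType d1) (T2 : measurableType d2)
    (P : probability T1 R) (f : T1 -> T2) (mf : measurable_fun setT f) :
    probability T2 R :=
  distribution P
    (MeasurableFun.Pack (MeasurableFun.Class (isMeasurableFun.Build _ _ _ _ f mf))).

Lemma Rintegral_law d1 d2 (T1 : measurableType d1) (T2 : measurableType d2)
    (P : probability T1 R) (f : T1 -> T2) (mf : measurable_fun setT f)
    (g : T2 -> R) :
  bounded_measurable g -> \int[law P mf]_x g x = \int[P]_x g (f x).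
Proof.
move=> bg; rewrite /Rintegral; congr fine; have [mg _] := bg.
apply: integral_pushforward => //; first exact/measurable_EFinP.
rewrite preimage_setT.
have -> : (fun x => (g x)%:E) \o f = EFin \o (fun x => g (f x)) by [].
exact/bounded_measurable_integrable/bounded_measurable_comp.
Qed.

(** * A threshold by iterated powers *)

Lemma bernoulli_ge (x : R) m : 0 <= x <= 1 -> 1 - m%:R * x <= (1 - x) ^+ m.
Proof.
move=> x01; elim: m => [|m IH]; first by rewrite expr0; lra.
rewrite exprSr -natr1; have [] := leP 0 (1 - m%:R * x) => h.
  have : (1 - m%:R * x) * (1 - x) <= (1 - x) ^+ m * (1 - x).
    by rewrite ler_wpM2r//; lra.
  have : 0 <= m%:R * (x * x) :> R by rewrite !mulr_ge0//; lra.
  nra.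
have : 0 <= (1 - x) ^+ m * (1 - x) by rewrite mulr_ge0 ?exprn_ge0//; lra.
nra.
Qed.

Lemma bernoulli_le (x : R) m : 0 <= x <= 1 -> (1 - x) ^+ m * (1 + m%:R * x) <= 1.
Proof.
move=> x01; elim: m => [|m IH]; first by rewrite expr0; lra.
apply: le_trans IH; rewrite exprSr -natr1 -mulrA ler_wpM2l ?exprn_ge0//; first lra.
have : 0 <= m%:R * (x * x) :> R by rewrite !mulr_ge0//; lra.
have : 0 <= x * x :> R by rewrite !mulr_ge0//; lra.
nra.
Qed.

(** With [s = sqrt q], split [n q^n] as [(n s^n) s^n]: the first factor is at
most [1 / (1 - s)] by [bernoulli_le], the second tends to [0]. *)
Lemma natmul_expr_cvg0 (q : R) : 0 <= q < 1 ->
  (n%:R * q ^+ n : R) @[n --> \oo] --> (0 : R).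
Proof.
move=> /andP[q0 q1]; set s := Num.sqrt q.
have s0 : 0 <= s by exact: sqrtr_ge0.
have ss : q = s * s by rewrite -expr2 sqr_sqrtr.
have s1 : s < 1 by rewrite -[ltRHS]sqrtr1 ltr_sqrt//; lra.
apply: (squeeze_cvgr (f := fun=> 0) (h := fun n => (1 - s)^-1 * s ^+ n)).
- apply: nearW => n; rewrite ss exprMn mulrA mulr_ge0 ?mulr_ge0 ?exprn_ge0//=.
  rewrite ler_wpM2r ?exprn_ge0// -[leRHS]mul1r ler_pdivlMr ?subr_gt0//.
  have : (1 - (1 - s)) ^+ n * (1 + n%:R * (1 - s)) <= 1 by apply: bernoulli_le; lra.
  have -> : 1 - (1 - s) = s by ring.
  have : 0 <= s ^+ n by rewrite exprn_ge0.
  lra.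
- exact: cvg_cst.
- by apply: cvg_geometric; rewrite ger0_norm.
Qed.

(** By the Bernoulli inequalities the limit is decided by the size of
[m u^n = n (2 u)^n], where [m = n 2^n].  The factor [n] in the exponent settles
the boundary case: with [m = 2^n] the value at [u = 1/2] would tend to [1/e]. *)
Lemma pow_threshold_cvg (u : R) : 0 <= u <= 1 ->
  (1 - u ^+ n) ^+ (n * 2 ^ n) @[n --> \oo] --> (if u < 2^-1 then 1 else 0 : R).
Proof.
move=> /andP[u0 u1].
have un n : 0 <= u ^+ n <= 1 by rewrite exprn_ge0//= exprn_ile1.
have e n : (n * 2 ^ n)%:R * u ^+ n = n%:R * (2 * u) ^+ n.
  by rewrite natrM natrX exprMn mulrA.
case: ltP => uh.
- apply: (squeeze_cvgr (f := fun n => 1 - n%:R * (2 * u) ^+ n) (h := fun=> 1)).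
  + apply: nearW => n; rewrite -e bernoulli_ge//=.
    by rewrite exprn_ile1//; have := un n; lra.
  + rewrite -[X in _ --> X]subr0; apply: cvgB; first exact: cvg_cst.
    by apply: natmul_expr_cvg0; lra.
  + exact: cvg_cst.
- apply: (squeeze_cvgr (f := fun=> 0) (h := harmonic)).
  + apply: nearW => n; rewrite exprn_ge0//=; last by have := un n; lra.
    have := bernoulli_le (n * 2 ^ n)%N (un n); rewrite e => le1.
    rewrite -[leRHS]mul1r ler_pdivlMr//; apply: le_trans le1.
    rewrite ler_wpM2l//; first by rewrite exprn_ge0//; have := un n; lra.
    rewrite -natr1 addrC lerD2l ler_peMr// exprn_ege1//; lra.
  + exact: cvg_cst.
  + exact: cvg_harmonic.
Qed.

(** * A law on the line is determined by its characteristic function *)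

Section CharacteristicFunctionUniqueness.
Variables mu nu : probability (measurableTypeR R) R.
Implicit Types f g : R -> R.

Definition same_mean f : Prop :=
  bounded_measurable (f : measurableTypeR R -> R) /\ \int[mu]_x f x = \int[nu]_x f x.

Lemma same_mean_lin a b f g :
  same_mean f -> same_mean g -> same_mean (fun x => a * f x + b * g x).
Proof.
move=> [bf ef] [bg eg]; split; first exact: bounded_measurable_lin.
by rewrite !Rintegral_lin// ef eg.
Qed.

Lemma same_mean_lim (F : nat -> R -> R) f M :
  (forall n, same_mean (F n)) -> (forall n x, `|F n x| <= M) ->
  (forall x, F ^~ x @ \oo --> f x) -> same_mean f.
Proof.
move=> sF FM Ff.
have mF n : measurable_fun [set: R] (F n) by case: (sF n) => [[]].
have mf : measurable_fun [set: R] f.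
  by apply: (measurable_fun_cvg (h := F)) => // x _; exact: Ff.
have fM x : `|f x| <= M.
  have /cvg_norm h := Ff x.
  by apply: (cvgr_to_le h); apply: nearW => n.
have bf : bounded_measurable f by split=> //; exists M.
split=> //.
have L (m : probability (measurableTypeR R) R) :
    \int[m]_x F n x @[n --> \oo] --> \int[m]_x f x.
  have := @dominated_convergence _ _ _ m setT measurableT
     (fun n x => (F n x)%:E) (EFin \o f) (cst M%:E).
  case => [|||||_ _].
  - by move=> n; apply/measurable_EFinP; exact: mF.
  - by apply/measurable_EFinP; exact: mf.
  - by apply: aeW => x _; apply: cvg_EFin; [exact: nearW|exact: Ff].
  - by apply: finite_measure_integrable_cst.
  - by apply: aeW => x n _; rewrite lee_fin.
  move=> h; apply: fine_cvg.
  rewrite fineK; first exact: h.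
  exact/integrable_fin_num/bounded_measurable_integrable.
apply: cvg_unique (L mu) _ => //.
rewrite (_ : (fun n => _) = (fun n => \int[nu]_x F n x)); first exact: L.
by apply/funext => n; case: (sF n).
Qed.

(** The measures [f mu] and [f nu] have the same Fourier transform; the phase [s]
covers cosine and sine at once, which makes the condition stable under
multiplication by a cosine. *)
Definition same_fourier f : Prop :=
  forall t s, same_mean (fun x => f x * cos (t * x + s)).

Lemma same_fourier_lin a b f g :
  same_fourier f -> same_fourier g ->
  same_fourier (fun x => a * f x + b * g x).
Proof.
move=> sf sg t s; have := same_mean_lin a b (sf t s) (sg t s).
by congr same_mean; apply/funext => x; ring.
Qed.

Lemma same_fourierM_cos f t s :
  same_fourier f -> same_fourier (fun x => f x * cos (t * x + s)).
Proof.
move=> sf t' s'.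
have := same_mean_lin 2^-1 2^-1 (sf (t + t') (s + s')) (sf (t - t') (s - s')).
congr same_mean; apply/funext => x.
have -> : (t + t') * x + (s + s') = (t * x + s) + (t' * x + s') by ring.
have -> : (t - t') * x + (s - s') = (t * x + s) - (t' * x + s') by ring.
by rewrite cosB cosD; field.
Qed.

Lemma same_fourier1 :
  (forall t, \int[mu]_x cos (t * x) = \int[nu]_x cos (t * x)) ->
  (forall t, \int[mu]_x sin (t * x) = \int[nu]_x sin (t * x)) ->
  same_fourier (fun=> 1).
Proof.
move=> Hc Hs t s.
have sc : same_mean (fun x => cos (t * x)).
  split; last exact: Hc.
  exact: bounded_measurable_cosZ.
have ss : same_mean (fun x => sin (t * x)).
  split; last exact: Hs.
  exact: bounded_measurable_sinZ.
have := same_mean_lin (cos s) (- sin s) sc ss.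
by congr same_mean; apply/funext => x; rewrite cosD; ring.
Qed.

(** With [u = (1 + cos (t x + s)) / 2], multiplication by [u], hence by [u^n]
and by [1 - u^n], preserves [same_fourier]. *)
Lemma same_fourier_threshold t s n m :
  same_fourier (fun=> 1) ->
  same_fourier
    (fun x => (1 - ((1 + cos (t * x + s)) / 2) ^+ n) ^+ m).
Proof.
move=> s1; pose f x : R := (1 + cos (t * x + s)) / 2.
have sf g : same_fourier g -> same_fourier (fun x => g x * f x).
  move=> sg; have := same_fourier_lin 2^-1 2^-1 sg (same_fourierM_cos t s sg).
  by congr same_fourier; apply/funext => x; rewrite /f; field.
have sfn k g : same_fourier g ->
    same_fourier (fun x => g x * f x ^+ k).
  elim: k g => [|k IH] g sg.
    by move: sg; congr same_fourier; apply/funext => x; rewrite expr0 mulr1.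
  have := sf _ (IH _ sg); congr same_fourier; apply/funext => x.
  by rewrite exprSr mulrA.
elim: m => [//|m IH].
have := same_fourier_lin 1 (-1) IH (sfn n _ IH).
by congr same_fourier; apply/funext => x; rewrite exprSr -/(f x); ring.
Qed.

Lemma same_fourier_mean f : same_fourier f -> same_mean f.
Proof.
move=> /(_ 0 0); congr same_mean; apply/funext => x.
by rewrite mul0r addr0 cos0 mulr1.
Qed.

(** The phase is chosen so that [u = (1 - sin (t (x - b))) / 2], which is below
the threshold [1/2] exactly where the sine is positive. *)
Lemma same_mean_sin_gt0 t b : same_fourier (fun=> 1) ->
  same_mean (fun x => if 0 < sin (t * (x - b)) then 1 else 0).
Proof.
move=> s1; pose s := pi / 2 - t * b.
have cE x : cos (t * x + s) = - sin (t * (x - b)).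
  have -> : t * x + s = t * (x - b) + pi / 2 by rewrite /s; ring.
  by rewrite cosDpihalf.
pose u x : R := (1 + cos (t * x + s)) / 2.
have u01 x : 0 <= u x <= 1.
  have := cos_le1 (t * x + s); have := cos_geN1 (t * x + s); rewrite /u; lra.
apply: (same_mean_lim (F := fun n x => (1 - u x ^+ n) ^+ (n * 2 ^ n)) (M := 1)).
- by move=> n; apply: same_fourier_mean; exact: same_fourier_threshold.
- move=> n x; have /andP[u0 u1] := u01 x.
  have h0 : 0 <= u x ^+ n by rewrite exprn_ge0.
  have h1 : u x ^+ n <= 1 by rewrite exprn_ile1.
  rewrite ger0_norm ?exprn_ge0 ?exprn_ile1//; lra.
- move=> x; have := pow_threshold_cvg (u01 x).
  suff -> : (u x < 2^-1) = (0 < sin (t * (x - b))) by [].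
  rewrite /u cE; apply/idP/idP; lra.
Qed.

(** For [t = 1 / (n + 1)] with [n] large, [t (x - b)] lies between [- pi] and
[pi], where the sine has the sign of its argument. *)
Lemma same_mean_gt b : same_fourier (fun=> 1) ->
  same_mean (fun x => if b < x then 1 else 0).
Proof.
move=> s1.
apply: (same_mean_lim (M := 1) (F := fun n x =>
  if 0 < sin (n.+1%:R^-1 * (x - b)) then 1 else 0)).
- by move=> n; exact: same_mean_sin_gt0.
- by move=> n x; case: ifP; rewrite ?normr1 ?normr0.
- move=> x; apply: cvg_near_cst; near=> n.
  have n0 : 0 < n.+1%:R :> R by [].
  have hn : `|x - b| < n.+1%:R * pi.
    have : `|x - b| <= n.+1%:R.
      rewrite -natr1 (@le_trans _ _ n%:R)// ?lerDl//.
      by near: n; exact: nbhs_infty_ger.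
    have : 0 < n.+1%:R * (pi - 1) :> R.
      by rewrite mulr_gt0// subr_gt0 (lt_le_trans _ (pi_ge2 _))// ltr1n.
    lra.
  have [bx|xb] := ltP b x.
    rewrite sin_gt0_pi ?mulr_gt0 ?invr_gt0 ?subr_gt0//=.
    by rewrite mulrC ltr_pdivrMr// mulrC (le_lt_trans (ler_norm _)).
  rewrite ltNge; case: (leP (sin _) 0) => //.
  rewrite -oppr_lt0 -sinN -mulrN opprB ltNge sin_ge0_pi//.
  rewrite mulr_ge0 ?subr_ge0 ?invr_ge0//= mulrC ler_pdivrMr// mulrC ltW//.
  by rewrite (le_lt_trans (ler_norm _))// distrC.
Unshelve. all: by end_near. Qed.

Lemma charfun_line_unique :
  (forall t, \int[mu]_x cos (t * x) = \int[nu]_x cos (t * x)) ->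
  (forall t, \int[mu]_x sin (t * x) = \int[nu]_x sin (t * x)) ->
  forall A : set (measurableTypeR R), measurable A -> mu A = nu A.
Proof.
move=> Hc Hs A mA; have s1 := same_fourier1 Hc Hs.
have I (m : probability (measurableTypeR R) R) b :
    (\int[m]_x (if (b < x)%R then 1 else 0))%R%:E = m `]b, +oo[%classic.
  transitivity (fine (\int[m]_x (\1_(`]b, +oo[%classic) x)%:E))%:E.
    congr (fine _)%:E; apply: eq_integral => x _; congr EFin.
    by rewrite indicE mem_setE in_itv/= andbT; case: ltP.
  rewrite integral_indic//= setIT fineK//; exact: fin_num_measure.
refine (@measure_unique _ R (measurableTypeR R) (@RGenOInfty.G R)
  (fun n => `](- n%:R), +oo[%classic) _ _ _ _ mu nu _ _ A _) => //.
- exact: RGenOInfty.measurableE.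
- move=> _ _ [a ->] [b ->]; exists (Num.max a b).
  apply/seteqP; split=> x /=; rewrite !in_itv/= !andbT gt_max.
    by move=> [-> ->].
  by move/andP.
- by move=> n; exists (- n%:R).
- apply/seteqP; split=> // x _; exists (Num.truncn `|x|).+1 => //=.
  rewrite in_itv/= andbT ltrNl (le_lt_trans _ (Num.Theory.truncnS_gt _))//.
  by rewrite -normrN ler_norm.
- move=> _ [b ->]; apply: etrans (esym (I mu b)) _; apply: etrans (I nu b).
  by congr EFin; exact: (same_mean_gt b s1).2.
- by move=> k; rewrite ltey_eq fin_num_measure.
Qed.

End CharacteristicFunctionUniqueness.

(** * Positive definite matrices *)

Lemma symmetricmxP n (A : 'M[R]_n) : reflect (A^T = A) (A \is symmetricmx).
Proof.
rewrite is_hermitianmxE expr0 scale1r map_mx_id//.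
by apply: (iffP eqP) => [{2}->|->].
Qed.

Lemma qformD n (A B : 'M[R]_n) x : qform (A + B) x = qform A x + qform B x.
Proof. by rewrite /qform mulmxDr mulmxDl mxE. Qed.

Lemma qformZ n (A : 'M[R]_n) a x : qform (a *: A) x = a * qform A x.
Proof. by rewrite /qform -scalemxAr -scalemxAl mxE. Qed.

Lemma qform_scale n (A : 'M[R]_n) a x : qform A (a *: x) = a ^+ 2 * qform A x.
Proof.
by rewrite /qform -scalemxAr [(a *: x)^T]linearZ/= -!scalemxAl !mxE mulrA.
Qed.

Lemma qform_congr n (A T : 'M[R]_n) x :
  qform (T *m A *m T^T) x = qform A (T^T *m x).
Proof. by rewrite /qform trmx_mul trmxK !mulmxA. Qed.

Lemma dotE n (x y : 'cV[R]_n) : dot x y = \sum_i x i ord0 * y i ord0.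
Proof. by rewrite /dot mxE; apply: eq_bigr => i _; rewrite mxE. Qed.

Lemma dotC n (x y : 'cV[R]_n) : dot x y = dot y x.
Proof. by rewrite !dotE; apply: eq_bigr => i _; rewrite mulrC. Qed.

Lemma dotDr n (x y z : 'cV[R]_n) : dot x (y + z) = dot x y + dot x z.
Proof. by rewrite /dot mulmxDr mxE. Qed.

Lemma dotZr n a (x y : 'cV[R]_n) : dot x (a *: y) = a * dot x y.
Proof. by rewrite /dot -scalemxAr mxE. Qed.

Lemma dotBr n (x y z : 'cV[R]_n) : dot x (y - z) = dot x y - dot x z.
Proof. by rewrite dotDr -scaleN1r dotZr mulN1r. Qed.

Lemma dot_mulmx n (T : 'M[R]_n) (x y : 'cV[R]_n) :
  dot x (T *m y) = dot (T^T *m x) y.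
Proof. by rewrite /dot trmx_mul trmxK mulmxA. Qed.

Lemma dot_ge0 n (x : 'cV[R]_n) : 0 <= dot x x.
Proof. by rewrite dotE sumr_ge0// => i _; rewrite -expr2 sqr_ge0. Qed.

Lemma dot_gt0 n (x : 'cV[R]_n) : x != 0 -> 0 < dot x x.
Proof.
move=> x0; rewrite lt_neqAle dot_ge0 andbT; apply: contraNneq x0 => /esym.
rewrite dotE => /psumr_eq0P h; apply/eqP/colP => i.
rewrite mxE; apply/eqP; rewrite -sqrf_eq0 expr2 h// => j _.
by rewrite -expr2 sqr_ge0.
Qed.

(** Polarization: the form at [e_i + e_j] isolates the entry [A i j]. *)
Lemma qform_polar n (A : 'M[R]_n) : A^T = A ->
  (forall x, qform A x = 0) -> A = 0.
Proof.
move=> sA A0; apply/matrixP => i j; rewrite mxE.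
have E k l : ((delta_mx k ord0 : 'cV[R]_n)^T *m A *m
    (delta_mx l ord0 : 'cV[R]_n)) ord0 ord0 = A k l.
  by rewrite trmx_delta -rowE -colE !mxE.
have := A0 (delta_mx i ord0 + delta_mx j ord0).
have := A0 (delta_mx i ord0); have := A0 (delta_mx j ord0).
rewrite /qform [(_ + _)^T]linearD/= !mulmxDl !mulmxDr !E => jj ii.
have addE (B C : 'M[R]_1) : (B + C) ord0 ord0 = B ord0 ord0 + C ord0 ord0.
  by rewrite mxE.
rewrite !addE !E jj ii.
have -> : A j i = A i j by rewrite -[in LHS]sA mxE.
lra.
Qed.

Definition posdefmx n (A : 'M[R]_n) : Prop :=
  forall x : 'cV[R]_n, x != 0 -> 0 < qform A x.

Lemma posdefmx_congr n (A T : 'M[R]_n) :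
  T \in unitmx -> posdefmx A -> posdefmx (T *m A *m T^T).
Proof.
move=> uT pA x x0; rewrite qform_congr pA//; apply: contraNneq x0 => Tx0.
have uT' : T^T \in unitmx by rewrite unitmx_tr.
by rewrite -(mulKmx uT' x) Tx0 mulmx0.
Qed.

(** The value of the Schur complement at [y] is the value of the block matrix at
[(- a^-1 b^T y, y)], where the form is least among the vectors ending in [y]. *)
Lemma posdefmx_schur n (a : R) (b : 'M[R]_(n, 1)) (C : 'M[R]_n) :
  posdefmx (block_mx a%:M b^T b C : 'M[R]_(1 + n)) ->
  0 < a /\ posdefmx (C - a^-1 *: (b *m b^T)).
Proof.
move=> pM.
have a0 : 0 < a.
  have /pM : col_mx 1%:M 0 != 0 :> 'cV[R]_(1 + n).
    rewrite -(col_mx0 R 1 n 1); apply: contraNneq (oner_neq0 R) => /eq_col_mx[].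
    by move=> /matrixP/(_ ord0 ord0)/eqP; rewrite !mxE eqxx.
  rewrite /qform tr_col_mx mul_row_block !trmx0 !mul0mx !addr0.
  by rewrite mul_row_col mulmx0 addr0 trmx1 mulmx1 mul1mx mxE mulr1n.
split=> // y y0.
pose x : 'cV[R]_(1 + n) := col_mx (- (a^-1 *: (b^T *m y))) y.
have x0 : x != 0.
  apply: contraNneq y0; rewrite /x -(col_mx0 R 1 n 1) => /eq_col_mx[_ ->].
  by [].
have := pM _ x0; congr (_ < _); rewrite /qform /x tr_col_mx mul_row_block.
have -> : (- (a^-1 *: (b^T *m y)))^T = - (a^-1 *: (y^T *m b)).
  by rewrite linearN/= linearZ/= trmx_mul trmxK.
rewrite mul_row_col [_ *m a%:M]mulNmx mul_mx_scalar.
rewrite scalerA divff ?gt_eqF// scale1r addNr mul0mx add0r mulNmx.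
congr (_ _ _); rewrite mulmxBr addrC; congr (_ *m _); congr (_ - _).
by rewrite -scalemxAl -scalemxAr mulmxA.
Qed.

Lemma cholesky n (M : 'M[R]_n) :
  M^T = M -> posdefmx M -> exists L : 'M[R]_n, M = L *m L^T.
Proof.
elim: n M => [|n IH] M sM pM; first by exists 0; rewrite [M]flatmx0 [RHS]flatmx0.
move: M sM pM; rewrite -[n.+1]/(1 + n)%N => M sM pM.
have [a [b [C [sC MM]]]] : exists a (b : 'M[R]_(n, 1)) (C : 'M[R]_n),
    C^T = C /\ M = block_mx a%:M b^T b C.
  exists (M ord0 ord0), (dlsubmx M), (drsubmx M); split.
    by rewrite trmx_drsub sM.
  rewrite trmx_dlsub sM -[LHS]submxK; congr block_mx.
  apply/matrixP => i j; rewrite !ord1 !mxE eqxx mulr1n.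
  by congr (M _ _); apply/val_inj.
rewrite MM in pM *; have [a0 pS] := posdefmx_schur pM.
have [|K KE] := IH (C - a^-1 *: (b *m b^T)) _ pS.
  by rewrite linearB/= linearZ/= trmx_mul trmxK sC.
pose s := Num.sqrt a.
have s0 : s != 0 by rewrite gt_eqF// sqrtr_gt0.
have ss : a = s * s by rewrite -expr2 sqr_sqrtr// ltW.
exists (block_mx s%:M 0 (s^-1 *: b) K).
rewrite tr_block_mx mulmx_block !trmx0 !mulmx0 !mul0mx !addr0 tr_scalar_mx.
congr block_mx.
- by rewrite -scalar_mxM ss.
- by rewrite linearZ/= mul_scalar_mx scalerA divff// scale1r.
- by rewrite mul_mx_scalar scalerA divff// scale1r.
- rewrite -KE linearZ/= -scalemxAl -scalemxAr scalerA -invfM -ss.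
  by rewrite addrC subrK.
Qed.

Lemma posdefmx_unit n (M : 'M[R]_n) : posdefmx M -> M \in unitmx.
Proof.
move=> pM; rewrite unitmxE unitfE; apply/det0P => -[v v0 vM].
have /pM : v^T != 0.
  by apply: contraNneq v0 => /(congr1 trmx); rewrite trmxK trmx0 => ->.
by rewrite /qform trmxK vM mul0mx mxE ltxx.
Qed.

(** A crude operator norm bound: [|y_i y_j| <= (y_i^2 + y_j^2) / 2 <= |y|^2]. *)
Lemma qform_bound n (B : 'M[R]_n) (y : 'cV[R]_n) :
  `|qform B y| <= (\sum_i \sum_j `|B i j|) * dot y y.
Proof.
have -> : qform B y = \sum_j \sum_i y i ord0 * B i j * y j ord0.
  rewrite /qform mxE; apply: eq_bigr => j _; rewrite mxE big_distrl/=.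
  by apply: eq_bigr => i _; rewrite mxE.
rewrite exchange_big/= mulr_suml; apply: le_trans (ler_norm_sum _ _ _) _.
apply: ler_sum => i _; rewrite mulr_suml.
apply: le_trans (ler_norm_sum _ _ _) _; apply: ler_sum => j _.
have ybound k : y k ord0 ^+ 2 <= dot y y.
  rewrite dotE (bigD1 k)//= expr2 lerDl sumr_ge0// => l _.
  by rewrite -expr2 sqr_ge0.
rewrite !normrM mulrAC mulrC ler_wpM2l//.
have := ybound i; have := ybound j; rewrite -!normrM.
move: (y i ord0) (y j ord0) (dot y y) => p q D qD pD.
rewrite ler_norml; apply/andP; split.
  have := sqr_ge0 (p + q); rewrite !expr2 in qD pD *; nra.
have := sqr_ge0 (p - q); rewrite !expr2 in qD pD *; nra.
Qed.

Lemma posdefmx_perturb n (B : 'M[R]_n) :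
  exists2 e : R, 0 < e & posdefmx (1%:M + e *: B).
Proof.
pose c : R := \sum_i \sum_j `|B i j|.
have c0 : 0 <= c by apply: sumr_ge0 => i _; apply: sumr_ge0.
exists (1 + c)^-1; first by rewrite invr_gt0; lra.
move=> y y0; rewrite qformD qformZ.
have -> : qform 1%:M y = dot y y by rewrite /qform mulmx1.
have := qform_bound B y; rewrite -/c ler_norml => /andP[lo _].
have yy := dot_gt0 y0.
have -> : dot y y + (1 + c)^-1 * qform B y =
    ((1 + c) * dot y y + qform B y) / (1 + c) by field; rewrite gt_eqF//; lra.
by rewrite divr_gt0//; lra.
Qed.

(** Factor [Sigma = L L^T]: up to congruence by [L], the claim is the case
[Sigma = 1], with [A] replaced by [B = L^-1 A L^-T].  There a Cholesky factor [K]
of [1 + e B] does it, and [T = L K L^-1] transports it back. *)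
Lemma congruence_perturb n (Sigma A : 'M[R]_n) :
  Sigma^T = Sigma -> posdefmx Sigma -> A^T = A ->
  exists (e : R) (T : 'M[R]_n),
    [/\ 0 < e, T \in unitmx & T *m Sigma *m T^T = Sigma + e *: A].
Proof.
move=> sS pS sA; have [L LE] := cholesky sS pS.
have uL : L \in unitmx.
  by have := posdefmx_unit pS; rewrite LE unitmx_mul => /andP[].
pose B := invmx L *m A *m (invmx L)^T.
have sB : B^T = B by rewrite /B !trmx_mul trmxK sA mulmxA.
have [e e0 pB] := posdefmx_perturb B.
have [|K KE] := cholesky _ pB.
  by rewrite linearD/= linearZ/= sB tr_scalar_mx.
have uK : K \in unitmx.
  by have := posdefmx_unit pB; rewrite KE unitmx_mul => /andP[].
exists e, (L *m K *m invmx L); split=> //.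
  by rewrite !unitmx_mul uL uK unitmx_inv.
rewrite LE !trmx_mul !mulmxA (mulmxKV uL).
rewrite -(mulmxA _ L^T) -(trmx_mul _ L) mulVmx// trmx1 mulmx1.
rewrite -(mulmxA L K) -KE mulmxDr mulmx1 mulmxDl -scalemxAr -scalemxAl.
congr (_ + _ *: _); rewrite /B !mulmxA mulmxV// mul1mx -mulmxA.
by rewrite -trmx_mul mulmxV// trmx1 mulmx1.
Qed.

(** * Laws of linear images of a random vector *)

Lemma continuous_dot n (xi : 'cV[R]_n) : continuous (fun x : 'cV[R]_n => dot x xi).
Proof.
have -> : (fun x : 'cV[R]_n => dot x xi) =
    (fun x => \sum_(i <- index_enum 'I_n) x i ord0 * xi i ord0).
  by apply/funext => x; rewrite dotE.
apply: continuous_big => [|i _ x]; first exact: add_continuous.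
apply: (@continuousM _ _ (fun x : 'cV[R]_n => x i ord0) (fun=> xi i ord0)).
  exact: coord_continuous.
exact: cst_continuous.
Qed.

Lemma continuous_cV (T : topologicalType) n (f : T -> 'cV[R]_n) :
  (forall i, continuous (fun x => f x i ord0)) -> continuous f.
Proof.
move=> cf x B [C nC sCB].
have /filter_forall : forall i, \forall y \near x, C i ord0 (f y i ord0).
  by move=> i; exact: (cf i x _ (nC i ord0)).
apply: filterS => y Cy; apply: sCB => i j; rewrite (ord1 j); exact: Cy.
Qed.

Lemma measurable_to_R n (f : 'cV[R]_n -> R) :
  continuous f -> measurable_fun [set: borelRd R n] (f : borelRd R n -> measurableTypeR R).
Proof.
move=> /continuousP cf.
apply: (measurability _ (RGenOpens.measurableE R)).
move=> _ [_ [a [b ->]] <-]; rewrite setTI.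
by apply: sub_sigma_algebra; exact/cf/interval_open.
Qed.

Lemma measurable_to_Rd n d (T : measurableType d) (f : T -> 'cV[R]_n) :
  (forall U, open U -> measurable (f @^-1` U)) ->
  measurable_fun [set: T] (f : T -> borelRd R n).
Proof.
move=> mf.
refine (@measurability _ _ T (borelRd R n) setT _ (@open 'cV[R]_n) erefl _).
by move=> _ [U oU <-]; rewrite setTI; exact: mf.
Qed.

Lemma measurable_dot n (xi : 'cV[R]_n) :
  measurable_fun [set: borelRd R n]
    (fun x => dot x xi : measurableTypeR R).
Proof. exact: (measurable_to_R (@continuous_dot n xi)). Qed.

Lemma measurable_affine n (T : 'M[R]_n) (v : 'cV[R]_n) :
  measurable_fun [set: borelRd R n] (fun x : borelRd R n => T *m x + v : borelRd R n).
Proof.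
have /continuousP cf : continuous (fun x : 'cV[R]_n => T *m x + v).
  apply: continuous_cV => i.
  rewrite (_ : (fun x => _) = (fun x => dot x (row i T)^T + v i ord0)).
    move=> x; apply: (@continuousD _ _ _ (fun x => dot x (row i T)^T) (fun=> v i ord0)).
      exact: continuous_dot.
    exact: cst_continuous.
  apply/funext => x; rewrite mxE; congr (_ + _).
  by rewrite dotC /dot trmxK -row_mul [RHS]mxE.
apply: measurable_to_Rd => U oU; apply: sub_sigma_algebra; exact: cf.
Qed.

Lemma measurable_line n (a : R) (x : 'cV[R]_n) :
  measurable_fun [set: measurableTypeR R]
    (fun s : measurableTypeR R => (s * a) *: x : borelRd R n).
Proof.
have /continuousP cf : continuous (fun s : R => (s * a) *: x).
  apply: continuous_cV => i.
  rewrite (_ : (fun s : R => _) = (fun s => s * (a * x i ord0))).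
    by move=> s; apply: cvgM; [exact: cvg_id|exact: cvg_cst].
  by apply/funext => s; rewrite mxE mulrA.
apply: measurable_to_Rd => U oU; apply: open_measurable; exact: cf.
Qed.

(** On the line spanned by [xi], the characteristic function of [P] is that of
the law of the scalar product with [xi]. *)
Lemma charfun_scale n (P : probability (borelRd R n) R) (xi : 'cV[R]_n) t :
  charfun P (t *: xi) =
  Complex (\int[law P (measurable_dot xi)]_s cos (t * s))
          (\int[law P (measurable_dot xi)]_s sin (t * s)).
Proof.
rewrite /charfun /cintegral.
rewrite (Rintegral_law _ _ (bounded_measurable_cosZ t)).
rewrite (Rintegral_law _ _ (bounded_measurable_sinZ t)).
by congr Complex; apply: eq_Rintegral => x _; rewrite /= dotZr.
Qed.

Lemma charfun_line n (P Q : probability (borelRd R n) R) (xi : 'cV[R]_n) :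
  (forall t, charfun P (t *: xi) = charfun Q (t *: xi)) ->
  forall B : set (measurableTypeR R), measurable B ->
  P [set x | B (dot x xi)] = Q [set x | B (dot x xi)].
Proof.
move=> PQ; apply: (@charfun_line_unique (law P (measurable_dot xi))
  (law Q (measurable_dot xi))) => t.
  by have := PQ t; rewrite !charfun_scale => -[].
by have := PQ t; rewrite !charfun_scale => -[].
Qed.

(** [expi (t * m)] is the characteristic function of the Dirac mass at [m]. *)
Lemma charfun_point_mass n (P : probability (borelRd R n) R) (xi : 'cV[R]_n) m :
  (forall t, charfun P (t *: xi) = expi (t * m)) ->
  P [set x | dot x xi = m] = 1%E.
Proof.
move=> Pm.
have I (g : R -> R) : measurable_fun [set: R] g ->
    \int[@dirac _ (measurableTypeR R) m R]_s g s = g m.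
  move=> mg; rewrite /Rintegral integral_dirac//; last exact/measurable_EFinP.
  by rewrite diracT mul1e.
have U := @charfun_line_unique (law P (measurable_dot xi))
  (@dirac _ (measurableTypeR R) m R).
have -> : 1%E = @dirac _ (measurableTypeR R) m R [set m] :> \bar R.
  by rewrite diracE mem_set.
apply: (U _ _ [set m]) => //.
- move=> t; have := Pm t; rewrite charfun_scale => -[-> _].
  by rewrite I//; exact: (bounded_measurable_cosZ t).1.
- move=> t; have := Pm t; rewrite charfun_scale => -[_ ->].
  by rewrite I//; exact: (bounded_measurable_sinZ t).1.
Qed.

(** For [x = 0] both sides are [0], whatever the value of [0^-1]. *)
Lemma orthproj_line n (x y : 'cV[R]_n) :
  orthproj <[x]>%VS y = (dot y x * (dot x x)^-1) *: x.
Proof.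
set h := _ *: x.
have Ph : h \in <[x]>%VS /\ forall z, z \in <[x]>%VS -> dot (y - h) z = 0.
  split; first exact/memvZ/memv_line.
  move=> _ /vlineP[c ->]; rewrite dotC dotBr /h dotZr !(dotC (c *: x)) !dotZr.
  have [->|x0] := eqVneq x 0.
    by rewrite /dot !mulmx0 !mxE !mulr0 subrr.
  by field; rewrite gt_eqF// dot_gt0.
have /getPex[] : exists h : 'cV[R]_n, [set h : 'cV[R]_n | h \in <[x]>%VS /\
  forall z, z \in <[x]>%VS -> dot (y - h) z = 0] h by exists h.
rewrite -/(orthproj _ _); set h' := orthproj _ _ => h'x Ph'.
apply/eqP; rewrite -subr_eq0; apply: contraTT isT => /dot_gt0.
have hh : h' - h \in <[x]>%VS by apply: rpredB => //; exact: Ph.1.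
have := Ph' _ hh; have := Ph.2 _ hh.
rewrite !(dotC _ (h' - h)) !dotBr; lra.
Qed.

Lemma eq_projm_line n (P Q : probability (borelRd R n) R) (x : 'cV[R]_n) :
  (forall t, charfun P (t *: x) = charfun Q (t *: x)) ->
  eq_projm P Q <[x]>%VS.
Proof.
move=> PQ B mB _; rewrite /projm /pushforward.
have -> : orthproj <[x]>%VS @^-1` B =
    [set y | ((fun s => (s * (dot x x)^-1) *: x) @^-1` B) (dot y x)].
  by apply/seteqP; split=> y /=; rewrite orthproj_line.
apply: charfun_line PQ _ _.
by rewrite -[X in measurable X]setTI; exact: measurable_line.
Qed.

(** * Characteristic functions of affine images *)

Lemma expi0 : expi 0 = 1 :> R[i].
Proof. by rewrite /expi cos0 sin0. Qed.

Lemma expiD (a b : R) : expi (a + b) = expi a * expi b.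
Proof.
rewrite /expi cosD sinD; apply/eqP; rewrite eq_complex /=.
by rewrite eqxx/= [X in _ == X]addrC mulrC [X in _ + X]mulrC addrC eqxx.
Qed.

Lemma expi_neq0 (a : R) : expi a != 0.
Proof.
apply: contraNneq (oner_neq0 R[i]) => a0.
by rewrite -expi0 -(subrr a) expiD a0 mul0r.
Qed.

Lemma charfun0 n (P : probability (borelRd R n) R) : charfun P 0 = 1.
Proof.
have -> : (0 : 'cV[R]_n) = 0 *: 0 by rewrite scale0r.
rewrite charfun_scale.
have I (mu : probability (measurableTypeR R) R) c : \int[mu]_s (cst c s) = c.
  by rewrite Rintegral_cst// [X in fine X]probability_setT mulr1.
rewrite (@eq_Rintegral _ _ _ _ setT (cst 1)) => [|s _]; last by rewrite mul0r cos0.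
rewrite I (@eq_Rintegral _ _ _ _ setT (cst 0)) => [|s _]; last by rewrite mul0r sin0.
by rewrite I.
Qed.

Lemma charfun_affine n (P : probability (borelRd R n) R) (T : 'M[R]_n) v xi :
  charfun (law P (measurable_affine T v)) xi =
  expi (dot v xi) * charfun P (T^T *m xi).
Proof.
have bdot w := @measurable_dot n w.
rewrite [LHS]/charfun /cintegral.
rewrite (Rintegral_law _ _ (bounded_measurable_comp (bdot xi) bounded_measurable_cos)).
rewrite (Rintegral_law _ _ (bounded_measurable_comp (bdot xi) bounded_measurable_sin)).
rewrite /charfun /cintegral /=.
set c := dot v xi; set w := T^T *m xi.
have dE x : dot (T *m x + v) xi = dot x w + c.
  by rewrite dotC dotDr dot_mulmx (dotC _ x) (dotC xi v).
have L a b := Rintegral_lin P a b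
  (bounded_measurable_comp (bdot w) bounded_measurable_cos)
  (bounded_measurable_comp (bdot w) bounded_measurable_sin).
have -> : \int[P]_x cos (dot (T *m x + v) xi) =
    cos c * \int[P]_x cos (dot x w) + - sin c * \int[P]_x sin (dot x w).
  by rewrite -L; apply: eq_Rintegral => x _; rewrite dE cosD; ring.
have -> : \int[P]_x sin (dot (T *m x + v) xi) =
    sin c * \int[P]_x cos (dot x w) + cos c * \int[P]_x sin (dot x w).
  by rewrite -L; apply: eq_Rintegral => x _; rewrite dE sinD; ring.
apply/eqP; rewrite eq_complex /=; apply/andP; split; apply/eqP; ring.
Qed.

Lemma charfun_eq_borel n (P Q : probability (borelRd R n) R) :
  eq_borel P Q -> charfun P =1 charfun Q.
Proof.
move=> PQ xi; rewrite /charfun /cintegral /Rintegral.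
by congr (Complex (fine _) (fine _)); apply: eq_measure_integral => A mA _; exact: PQ.
Qed.

Lemma nondegenerate_charfun n (P : probability (borelRd R n) R) xi m :
  nondegenerate_measure P -> xi != 0 ->
  ~ forall t, charfun P (t *: xi) = expi (t * m).
Proof.
move=> nP xi0 /charfun_point_mass; apply: nP; exists xi, m; split=> //.
by apply/seteqP; split=> x /=; rewrite dotC.
Qed.

(** The inverse image of a hyperplane under an invertible affine map is a
hyperplane. *)
Lemma nondegenerate_affine n (P : probability (borelRd R n) R) (T : 'M[R]_n) v :
  T \in unitmx -> nondegenerate_measure P ->
  nondegenerate_measure (law P (measurable_affine T v)).
Proof.
move=> uT nP _ [y [c [y0 ->]]].
have uT' : T^T \in unitmx by rewrite unitmx_tr.
have -> : law P (measurable_affine T v) [set x | dot y x = c] =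
    P [set x | dot (T^T *m y) x = c - dot y v].
  congr (P _); apply/seteqP; split=> x /=; rewrite dotDr dot_mulmx => h.
    by rewrite -h addrK.
  by rewrite h subrK.
apply: nP; exists (T^T *m y), (c - dot y v); split=> //.
by apply: contraNneq y0 => Ty0; rewrite -(mulKmx uT' y) Ty0 mulmx0.
Qed.

(** * Functions invariant under a dilation *)

(** [psi u = psi (r^n u)], which tends to [psi 0]. *)
Lemma dilation_invariant (V : topologicalType) (psi : R -> V) (r : R) :
  hausdorff_space V ->
  {within `[0, +oo[, continuous psi} -> 0 <= r < 1 ->
  (forall u, 0 <= u -> psi (r * u) = psi u) ->
  forall u, 0 <= u -> psi u = psi 0.
Proof.
move=> hV /subspace_continuousP cpsi /andP[r0 r1] rpsi u u0.
have c0 : psi @ within `[0, +oo[ (nbhs (0 : R)) --> psi 0.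
  by apply: cpsi; rewrite /= in_itv/= lexx.
have rn : (u * r ^+ n)%R @[n --> \oo] --> (0 : R).
  by apply: cvg_geometric; rewrite ger0_norm.
have psin n : psi (u * r ^+ n) = psi u.
  elim: n => [|n IH]; first by rewrite expr0 mulr1.
  by rewrite exprS mulrCA rpsi// mulr_ge0// exprn_ge0.
have : psi (u * r ^+ n) @[n --> \oo] --> psi 0.
  move=> B Bpsi; have B0 := c0 _ Bpsi.
  have rB : \forall n \near \oo, `[0, +oo[%classic (u * r ^+ n) ->
    B (psi (u * r ^+ n)) by exact: rn _ B0.
  change (\forall n \near \oo, B (psi (u * r ^+ n))).
  apply: filterS rB => n; apply.
  by rewrite /= in_itv/= andbT mulr_ge0// exprn_ge0.
under eq_cvg do rewrite psin.
by move=> h; apply: cvg_unique h; [exact: hV|exact: cvg_cst].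
Qed.

(** Invariance under the ratio of the two scales. *)
Lemma two_scale_invariant (V : topologicalType) (psi : R -> V) (a b : R) :
  hausdorff_space V ->
  {within `[0, +oo[, continuous psi} -> 0 < a -> 0 < b -> a != b ->
  (forall s, 0 <= s -> psi (s * a) = psi (s * b)) ->
  forall u, 0 <= u -> psi u = psi 0.
Proof.
move=> hV cpsi; wlog ab : a b / a < b.
  move=> H a0 b0; rewrite neq_lt => /orP[ab|ba] h.
    by apply: (H a b) => //; rewrite lt_eqF.
  by apply: (H b a) => //; [rewrite lt_eqF|move=> s s0; rewrite h].
move=> a0 b0 _ h; apply: (@dilation_invariant _ _ (a / b)) => //.
  by rewrite divr_ge0 ?ltW//= ltr_pdivrMr// mul1r.
move=> u u0; have ub : 0 <= u / b by rewrite divr_ge0// ltW.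
by have := h _ ub; rewrite divfK ?gt_eqF// => <-; congr psi; ring.
Qed.

End EllipticalDistributions.

Theorem theorem2 (R : realType) (d : nat) (hd : (1 <= d)%N)
  (P : probability (borelRd R d) R) (S : set 'cV[R]_d)
  (Pnd : nondegenerate_measure P) (Pell : elliptical P)
  (hS : ~ sym_uniqueness_set S) :
  exists Q : probability (borelRd R d) R,
    [/\ nondegenerate_measure Q, elliptical Q,
        forall x : 'cV[R]_d, S x -> eq_projm P Q <[x]>%VS &
        ~ eq_borel P Q].
Proof.
have [mu [Sigma [psi [[/symmetricmxP symS psdS] cpsi cP]]]] := Pell.
have psi0 : psi 0 = 1.
  have := cP 0; rewrite charfun0 -(scale0r mu) dotZr qform_scale expr0n/=.
  by rewrite !mul0r expi0 mul1r.
(* Such a [psi] makes [P] a point mass in the direction [x]. *)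
have const_absurd x : x != 0 -> ~ (forall t, psi (qform Sigma (t *: x)) = 1).
  move=> x0 psi1; apply: (@nondegenerate_charfun _ _ P x (dot mu x)) => // t.
  by rewrite cP psi1 mulr1 dotZr.
have posS : posdefmx Sigma.
  move=> x x0; rewrite lt_neqAle psdS andbT; apply/eqP => S0.
  by apply: (const_absurd x x0) => t; rewrite qform_scale -S0 mulr0.
have [A [symA AS A0]] : exists A : 'M[R]_d,
    [/\ A^T = A, forall x, S x -> qform A x = 0 & A <> 0].
  apply: contrapT => noA; apply: hS => A /symmetricmxP symA AS.
  by apply: contrapT => A0; apply: noA; exists A.
have [e [T [e0 uT TE]]] := congruence_perturb symS posS symA.
pose Q := law P (measurable_affine T (mu - T *m mu)).
have cQ xi : charfun Q xi = expi (dot mu xi) * psi (qform (Sigma + e *: A) xi).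
  rewrite charfun_affine cP -TE qform_congr mulrA -expiD.
  by rewrite [dot mu (_ *m _)]dotC -dot_mulmx (dotC _ xi) -dotDr subrK dotC.
have posQ : posdefmx (Sigma + e *: A).
  by rewrite -TE; exact: posdefmx_congr.
exists Q; split.
- exact: nondegenerate_affine.
- exists mu, (Sigma + e *: A), psi; split=> //; split.
    by apply/symmetricmxP; rewrite linearD/= linearZ/= symS symA.
  move=> x; have [->|x0] := eqVneq x 0; last exact/ltW/posQ.
  by rewrite -(scale0r x) qform_scale expr0n/= mul0r.
- move=> x Sx; apply: eq_projm_line => t.
  by rewrite cP cQ qformD qformZ !qform_scale AS// !mulr0 addr0.
- move=> /charfun_eq_borel PQ.
  have [x Ax] : exists x, qform A x != 0.
    apply: contrapT => noA; apply: A0; apply: qform_polar => // x.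
    by apply: contrapT => /eqP Ax; apply: noA; exists x.
  have x0 : x != 0.
    by apply: contraNneq Ax => ->; rewrite -(scale0r x) qform_scale expr0n/= mul0r.
  apply: (const_absurd x x0) => t; rewrite -psi0.
  apply: (@two_scale_invariant _ (complex R)^o _ (qform Sigma x) (qform (Sigma + e *: A) x)) => //.
  + exact: posS.
  + exact: posQ.
  + rewrite qformD qformZ -subr_eq0 opprD addrA subrr add0r oppr_eq0.
    by rewrite mulf_neq0// gt_eqF.
  (* The forms scale quadratically, so the dilation by s is reached at sqrt s. *)
  + move=> s s0; have := PQ (Num.sqrt s *: x).
    rewrite cP cQ => /(mulfI (expi_neq0 _)).
    by rewrite !qform_scale sqr_sqrtr.
Qed.
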